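(* Consider a finite MDP with feature mapping $\mathbf{x}:\mathcal{S}\to\mathbb{R}^m$, discount $\gamma\in[0,1)$, a data-generating policy $b$, a policy $\pi$ to be evaluated, and a search-control feature distribution $\zeta$. Suppose that 1. the Markov chain induced by $b$ is ergodic, and $\mathbb{E}_b[\mathbb{I}(A_t=a)\mathbf{x}_t\mathbf{x}_t^\top]$ is non-singular for every $a\in\mathcal{A}$; 2. $\zeta=\mu$, the stationary feature-vector distribution of $b$; and that the three fixed points $\mathbf{w}_{\text{env}},\mathbf{w}_{\text{non-linear}},\mathbf{w}_{\text{linear}}$ (defined in the context) all exist, i.e. the matrices inverted in their definitions are non-singular. Then in general $$\mathbf{w}_{\text{env}}=\mathbf{w}_{\text{non-linear}}\neq\mathbf{w}_{\text{linear}}.$$ That is, under these hypotheses the equality $\mathbf{w}_{\text{env}}=\mathbf{w}_{\text{non-linear}}$ holds, whereas $\mathbf{w}_{\text{linear}}$ need not equal them: there exist a finite MDP, a feature mapping, a discount factor and policies $b,\pi$ satisfying these hypotheses (with $\zeta=\mu$) for which $\mathbf{w}_{\text{linear}}\neq\mathbf{w}_{\text{env}}=\mathbf{w}_{\text{non-linear}}$.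
   Context: The MDP has finite state, action and reward sets $\mathcal{S},\mathcal{A},\mathcal{R}$ and dynamics $p(s',r\mid s,a)=\Pr(S_{t+1}=s',R_{t+1}=r\mid S_t=s,A_t=a)$. Write $\mathbf{x}_t=\mathbf{x}(S_t)$. Policies depend on the state only through its feature vector: $b(a\mid\boldsymbol\phi)$, $\pi(a\mid\boldsymbol\phi)$. Let $\eta$ be the unique stationary state distribution of the (ergodic) chain induced by $b$. $\mathbb{E}_b[\cdot]$ denotes expectation with $S_t\sim\eta$, $A_t\sim b(\cdot\mid\mathbf{x}_t)$, $(S_{t+1},R_{t+1})\sim p(\cdot,\cdot\mid S_t,A_t)$. For a feature vector $\boldsymbol\phi$, $H_{\boldsymbol\phi}=\{s\in\mathcal{S}:\mathbf{x}(s)=\boldsymbol\phi\}$ and $\mu(\boldsymbol\phi)=\sum_{s\in H_{\boldsymbol\phi}}\eta(s)$. $\mathbb{E}_\zeta[\cdot]$ denotes expectation with $\boldsymbol\phi_k\sim\zeta$, $A_k\sim\pi(\cdot\mid\boldsymbol\phi_k)$. $\mathbb{I}$ is the indicator and $\rho_t=\pi(A_t\mid\mathbf{x}_t)/b(A_t\mid\mathbf{x}_t)$ is the importance sampling ratio. Best linear expectation model: for each $a$, $\mathbf{F}_a^*=\arg\min_{\mathbf{G}}\mathbb{E}_b[\mathbb{I}(A_t=a)\|\mathbf{G}\mathbf{x}_t-\mathbf{x}_{t+1}\|_2^2]=\mathbb{E}_b[\mathbb{I}(A_t=a)\mathbf{x}_{t+1}\mathbf{x}_t^\top]\,\mathbb{E}_b[\mathbb{I}(A_t=a)\mathbf{x}_t\mathbf{x}_t^\top]^{-1}$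 and $\mathbf{b}_a^*=\arg\min_{\mathbf{u}}\mathbb{E}_b[\mathbb{I}(A_t=a)(\mathbf{u}^\top\mathbf{x}_t-R_{t+1})^2]=\mathbb{E}_b[\mathbb{I}(A_t=a)\mathbf{x}_t\mathbf{x}_t^\top]^{-1}\mathbb{E}_b[\mathbb{I}(A_t=a)\mathbf{x}_tR_{t+1}]$. Best non-linear expectation model: $\hat{\mathbf{x}}^*(\boldsymbol\phi,a)=\mathbb{E}_b[\mathbf{x}_{t+1}\mid\mathbf{x}_t=\boldsymbol\phi,A_t=a]=\frac{1}{\mu(\boldsymbol\phi)}\sum_{s\in H_{\boldsymbol\phi}}\eta(s)\,\mathbb{E}_b[\mathbf{x}(S_{t+1})\mid S_t=s,A_t=a]$ and $\hat r^*(\boldsymbol\phi,a)=\mathbb{E}_b[R_{t+1}\mid\mathbf{x}_t=\boldsymbol\phi,A_t=a]=\frac{1}{\mu(\boldsymbol\phi)}\sum_{s\in H_{\boldsymbol\phi}}\eta(s)\,\mathbb{E}_b[R_{t+1}\mid S_t=s,A_t=a]$. Fixed points of the expected TD(0) updates: - (off-policy TD(0) on real data) $\mathbf{w}_{\text{env}}=\mathbb{E}_b[\rho_t\mathbf{x}_t(\mathbf{x}_t-\gamma\mathbf{x}_{t+1})^\top]^{-1}\,\mathbb{E}_b[\rho_tR_{t+1}\mathbf{x}_t]$; - (best non-linear model) $\mathbf{w}_{\text{non-linear}}=\mathbb{E}_\zeta[\boldsymbol\phi_k(\boldsymbol\phi_k-\gamma\hat{\mathbf{x}}^*(\boldsymbol\phi_k,A_k))^\top]^{-1}\,\mathbb{E}_\zeta[\hat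 r^*(\boldsymbol\phi_k,A_k)\boldsymbol\phi_k]$; - (best linear model) $\mathbf{w}_{\text{linear}}=(\mathbf{I}-\gamma\mathbf{F}^\top)^{-1}\mathbf{b}$, where $\mathbf{I}$ is the identity matrix, $\mathbf{F}=\mathbb{E}_\zeta[\mathbf{F}^*_{A_k}\boldsymbol\phi_k\boldsymbol\phi_k^\top]\,\mathbb{E}_\zeta[\boldsymbol\phi_k\boldsymbol\phi_k^\top]^{-1}$ and $\mathbf{b}=\mathbb{E}_\zeta[\boldsymbol\phi_k\boldsymbol\phi_k^\top]^{-1}\,\mathbb{E}_\zeta[\boldsymbol\phi_k\boldsymbol\phi_k^\top\mathbf{b}^*_{A_k}]$.
   Formalization: The formal statement adds coverage: whenever μ(φ)>0 and π(a|φ)>0, also b(a|φ)>0; without it the importance ratios and conditional expectations in the best non-linear model are undefined or the equality w_env = w_non-linear fails. *)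

(* Defs.v *)
From HB Require Import structures.
From mathcomp Require Import all_boot all_order all_algebra finmap.
From mathcomp Require Import boolp classical_sets cardinality fsbigop reals.

Set Implicit Arguments.
Unset Strict Implicit.
Unset Printing Implicit Defensive.
Import Order.TTheory GRing.Theory Num.Theory.
Local Open Scope classical_set_scope.
Local Open Scope ring_scope.

(* [dyn M s' r s a] is p(s', r | s, a); rewards range over a finite set of
   reals. *)
Record mdp (R : realType) := Mdp {
  state : finType;
  action : finType;
  rewards : {fset R};
  dyn : state -> rewards -> state -> action -> R;
  dyn_ge0 : forall s' r s a, 0 <= dyn s' r s a;
  dyn_sum1 : forall s a, \sum_s' \sum_r dyn s' r s a = 1
}.

(* Policies see the state only through a feature vector. *)
Record policy (R : realType) (m : nat) (A : finType) := Policy {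
  policy_fun :> 'cV[R]_m -> A -> R;
  policy_ge0 : forall phi a, 0 <= policy_fun phi a;
  policy_sum1 : forall phi, \sum_a policy_fun phi a = 1
}.

Section MarkovChain.
Context {R : realType} {S : finType}.
Implicit Types (P : S -> S -> R) (eta : S -> R).

Fixpoint nstep P (n : nat) (s s' : S) : R :=
  if n is n'.+1 then \sum_u P s u * nstep P n' u s' else (s == s')%:R.

Definition irreducible P := forall s s', exists n, 0 < nstep P n s s'.

Definition aperiodic P :=
  forall s (d : nat),
    (forall n, (0 < n)%N -> 0 < nstep P n s s -> (d %| n)%N) -> d = 1%N.

Definition ergodic P := irreducible P /\ aperiodic P.

Definition stationary P eta :=
  [/\ forall s, 0 <= eta s,
      \sum_s eta s = 1
    & forall s', \sum_s eta s * P s s' = eta s'].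

End MarkovChain.

Definition finite_pmf (R : realType) (T : choiceType) (q : T -> R) :=
  [/\ forall t, 0 <= q t,
      finite_set [set t | q t != 0]
    & \sum_(t \in [set: T]) q t = 1].

Section TD.
Context {R : realType} (M : mdp R) (m : nat).
Context (x : state M -> 'cV[R]_m) (gamma : R).
Context (b pi : policy R m (action M)).
Context (eta : state M -> R) (zeta : 'cV[R]_m -> R).

Definition behaviour_chain (s s' : state M) : R :=
  \sum_a b (x s) a * \sum_r dyn s' r s a.

Definition mu (phi : 'cV[R]_m) : R := \sum_(s | x s == phi) eta s.

(* Expectation of f(S_t, A_t, S_{t+1}, R_{t+1}) with S_t ~ eta, A_t ~ b. *)
Definition Eb (V : lmodType R)
    (f : state M -> action M -> state M -> R -> V) : V :=
  \sum_s \sum_a \sum_s' \sum_(r : rewards M)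
    (eta s * b (x s) a * dyn s' r s a) *: f s a s' (val r).

(* E_b[f | x_t = phi, A_t = a]; it is meaningful when the conditioning event
   has positive probability, and is 0 otherwise. *)
Definition Eb_cond (V : lmodType R)
    (f : state M -> action M -> state M -> R -> V)
    (phi : 'cV[R]_m) (a : action M) : V :=
  (Eb (V := R^o) (fun s a' _ _ => ((x s == phi) && (a' == a))%:R))^-1 *:
  Eb (fun s a' s' r => ((x s == phi) && (a' == a))%:R *: f s a' s' r).

(* Expectation of f(phi_k, A_k) with phi_k ~ zeta, A_k ~ pi. The outer sum is
   over a finitely supported family as soon as [finite_pmf zeta]. *)
Definition Ezeta (V : lmodType R) (f : 'cV[R]_m -> action M -> V) : V :=
  \sum_(phi \in [set: 'cV[R]_m]) \sum_a (zeta phi * pi phi a) *: f phi a.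

Definition rho (s : state M) (a : action M) : R := pi (x s) a / b (x s) a.

Definition second_moment (a : action M) : 'M[R]_m :=
  Eb (fun s a' _ _ => (a' == a)%:R *: (x s *m (x s)^T)).

Definition Fstar (a : action M) : 'M[R]_m :=
  Eb (fun s a' s' _ => (a' == a)%:R *: (x s' *m (x s)^T))
    *m invmx (second_moment a).

Definition bstar (a : action M) : 'cV[R]_m :=
  invmx (second_moment a)
    *m Eb (fun s a' _ r => (a' == a)%:R *: (r *: x s)).

Definition xhat (phi : 'cV[R]_m) (a : action M) : 'cV[R]_m :=
  Eb_cond (fun _ _ s' _ => x s') phi a.

Definition rhat (phi : 'cV[R]_m) (a : action M) : R :=
  Eb_cond (V := R^o) (fun _ _ _ r => r) phi a.

Definition A_env : 'M[R]_m :=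
  Eb (fun s a s' _ => rho s a *: (x s *m (x s - gamma *: x s')^T)).

Definition w_env : 'cV[R]_m :=
  invmx A_env *m Eb (fun s a _ r => (rho s a * r) *: x s).

Definition A_nonlinear : 'M[R]_m :=
  Ezeta (fun phi a => phi *m (phi - gamma *: xhat phi a)^T).

Definition w_nonlinear : 'cV[R]_m :=
  invmx A_nonlinear *m Ezeta (fun phi a => rhat phi a *: phi).

Definition zeta_moment : 'M[R]_m := Ezeta (fun phi _ => phi *m phi^T).

Definition F_lin : 'M[R]_m :=
  Ezeta (fun phi a => Fstar a *m phi *m phi^T) *m invmx zeta_moment.

Definition b_lin : 'cV[R]_m :=
  invmx zeta_moment *m Ezeta (fun phi a => phi *m phi^T *m bstar a).

Definition A_linear : 'M[R]_m := 1%:M - gamma *: F_lin^T.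

Definition w_linear : 'cV[R]_m := invmx A_linear *m b_lin.

(* [td_coverage] is the standing requirement that the importance sampling
   ratios and the conditional expectations E_b[. | x_t = phi, A_t = a] be
   well defined wherever pi takes action a. *)
Record td_setting : Prop := TdSetting {
  td_gamma : 0 <= gamma < 1;
  td_ergodic : ergodic behaviour_chain;
  td_stationary : stationary behaviour_chain eta;
  td_second_moment : forall a, second_moment a \in unitmx;
  td_coverage : forall phi a, 0 < mu phi -> 0 < pi phi a -> 0 < b phi a;
  td_zeta : finite_pmf zeta;
  td_zeta_mu : zeta = mu;
  td_A_env : A_env \in unitmx;
  td_A_nonlinear : A_nonlinear \in unitmx;
  td_zeta_moment : zeta_moment \in unitmx;
  td_A_linear : A_linear \in unitmx
}.

Definition sqnorm n (v : 'cV[R]_n) : R := \sum_i v i 0 ^+ 2.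

Definition Fstar_loss (a : action M) (G : 'M[R]_m) : R :=
  Eb (V := R^o) (fun s a' s' _ => (a' == a)%:R * sqnorm (G *m x s - x s')).

Definition bstar_loss (a : action M) (u : 'cV[R]_m) : R :=
  Eb (V := R^o) (fun s a' _ r => (a' == a)%:R * ((u^T *m x s) 0 0 - r) ^+ 2).

Lemma Eb_morph (V W : lmodType R) (h : {linear V -> W}) f :
  h (Eb f) = Eb (fun s a s' r => h (f s a s' r)).
Proof.
rewrite /Eb; do 4![rewrite linear_sum; apply: eq_bigr => ? _].
exact: linearZ.
Qed.

Lemma eq_Eb (V : lmodType R) f g :
  (forall s a s' r, f s a s' r = g s a s' r) -> Eb f = Eb g :> V.
Proof. by move=> fg; do 4![apply: eq_bigr => ? _]; rewrite fg. Qed.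

Lemma EbD (V : lmodType R) f g :
  Eb (fun s a s' r => f s a s' r + g s a s' r) = Eb f + Eb g :> V.
Proof.
rewrite /Eb; do 4![rewrite -big_split; apply: eq_bigr => ? _].
exact: scalerDr.
Qed.

(* In particular xhat and rhat are the mu-normalized, eta-weighted averages
   over the states sharing the feature vector phi. *)
Lemma Eb_cond_state (V : lmodType R)
    (f : state M -> action M -> state M -> R -> V) phi a :
  0 < b phi a ->
  Eb_cond f phi a = (mu phi)^-1 *: \sum_(s | x s == phi)
    eta s *: \sum_s' \sum_(r : rewards M) dyn s' r s a *: f s a s' (val r).
Proof.
move=> b0; have mass (W : lmodType R) g :
    Eb (fun s a' s' r => ((x s == phi) && (a' == a))%:R *: g s a' s' r) =
    b phi a *: \sum_(s | x s == phi) eta s *: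
      \sum_s' \sum_(r : rewards M) dyn s' r s a *: g s a s' (val r) :> W.
  rewrite scaler_sumr [RHS]big_mkcond; apply: eq_bigr => s _.
  case: eqP => [<-|_]; last first.
    by do 3![rewrite big1 // => ? _]; rewrite scale0r scaler0.
  rewrite (bigD1 a) //= [X in _ + X]big1 ?addr0 => [|a' /negPf ->]; last first.
    by do 2![rewrite big1 // => ? _]; rewrite scale0r scaler0.
  rewrite eqxx scalerA scaler_sumr; apply: eq_bigr => s' _.
  rewrite scaler_sumr; apply: eq_bigr => r _.
  by rewrite scale1r scalerA [b _ _ * _]mulrC.
rewrite /Eb_cond mass.
have -> : Eb (V := R^o) (fun s a' _ _ => ((x s == phi) && (a' == a))%:R) =
    b phi a * mu phi.
  have -> : mu phi = \sum_(s | x s == phi) eta s *: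
      \sum_s' \sum_(r : rewards M) dyn s' r s a *: (1 : R^o).
    apply: eq_bigr => s _; rewrite -[LHS]mulr1 -[in LHS](dyn_sum1 s a); congr (_ * _).
    by do 2![apply: eq_bigr => ? _]; exact: esym (mulr1 _).
  rewrite -[RHS](mass R^o (fun=> fun=> fun=> fun=> 1)).
  by apply: eq_Eb => s a' _ _; rewrite -[LHS]mulr1.
by rewrite scalerA invfM mulrAC mulVf ?mul1r // gt_eqF.
Qed.

Section LeastSquares.
Context (eta_ge0 : forall s, 0 <= eta s).

Let weight_ge0 s a s' r : 0 <= eta s * b (x s) a * dyn s' r s a.
Proof. by rewrite !mulr_ge0 ?policy_ge0 ?dyn_ge0. Qed.

Lemma Eb_ge0 f :
  (forall s a s' r, 0 <= f s a s' r) -> 0 <= Eb (V := R^o) f.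
Proof. by move=> f0; do 4![apply: sumr_ge0 => ? _]; apply: mulr_ge0. Qed.

Lemma Eb_eq0 (V : lmodType R) f (g : state M -> action M -> state M -> R -> V) :
    (forall s a s' r, 0 <= f s a s' r) ->
    (forall s a s' r, f s a s' r = 0 -> g s a s' r = 0) ->
  Eb (V := R^o) f = 0 -> Eb g = 0.
Proof.
move=> f0 fg E0.
have t0 s a s' r : 0 <= eta s * b (x s) a * dyn s' r s a * f s a s' (val r).
  exact: mulr_ge0.
rewrite /Eb big1 // => s _; rewrite big1 // => a _.
rewrite big1 // => s' _; rewrite big1 // => r _.
have E1 s0 := @psumr_eq0P _ _ _ _ (fun s _ => sumr_ge0 _ (fun a _ =>
  sumr_ge0 _ (fun s' _ => sumr_ge0 _ (fun r _ => t0 s a s' r)))) E0 s0 isT.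
have E2 a0 := @psumr_eq0P _ _ _ _ (fun a _ => sumr_ge0 _ (fun s' _ =>
  sumr_ge0 _ (fun r _ => t0 s a s' r))) (E1 s) a0 isT.
have E3 s0 := @psumr_eq0P _ _ _ _ (fun s' _ => sumr_ge0 _
  (fun r _ => t0 s a s' r)) (E2 a) s0 isT.
have /eqP := @psumr_eq0P _ _ _ _ (fun r _ => t0 s a s' r) (E3 s') r isT.
rewrite mulf_eq0 => /orP[/eqP ->|/eqP /fg ->]; by rewrite ?scale0r ?scaler0.
Qed.

Lemma sqnormE n (v : 'cV[R]_n) : sqnorm v = \tr (v *m v^T).
Proof.
by apply: eq_bigr => i _; rewrite mxE big_ord1 mxE expr2.
Qed.

Lemma sqnorm_ge0 n (v : 'cV[R]_n) : 0 <= sqnorm v.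
Proof. by apply: sumr_ge0 => i _; apply: sqr_ge0. Qed.

Lemma sqnorm_eq0 n (v : 'cV[R]_n) : sqnorm v = 0 -> v = 0.
Proof.
move=> /psumr_eq0P v0; apply/colP => i; rewrite mxE; apply/eqP.
by rewrite -sqrf_eq0 v0 // => j _; apply: sqr_ge0.
Qed.

Lemma least_squares n (y : state M -> action M -> state M -> R -> 'cV[R]_n)
    (a : action M) (G : 'M[R]_(n, m)) :
  let F := Eb (fun s a' s' r => (a' == a)%:R *: (y s a' s' r *m (x s)^T))
             *m invmx (second_moment a) in
  let loss (G : 'M[R]_(n, m)) :=
    Eb (V := R^o)
      (fun s a' s' r => (a' == a)%:R * sqnorm (G *m x s - y s a' s' r)) in
  second_moment a \in unitmx -> G != F -> loss F < loss G.
Proof.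
move=> F loss Cu GF; pose H := G - F.
have crossE : Eb (V := R^o) (fun s a' s' r => (a' == a)%:R *
    \tr ((F *m x s - y s a' s' r) *m (x s)^T *m H^T)) = 0.
  have -> : Eb (V := R^o) (fun s a' s' r => (a' == a)%:R *
      \tr ((F *m x s - y s a' s' r) *m (x s)^T *m H^T)) =
    \tr ((F *m second_moment a -
      Eb (fun s a' s' r => (a' == a)%:R *: (y s a' s' r *m (x s)^T))) *m H^T).
    rewrite /second_moment (Eb_morph (mulmx F)) -scaleN1r.
    rewrite (Eb_morph ( *:%R (-1))) -EbD.
    rewrite -[_ *m H^T]/(mulmxr H^T _) (Eb_morph (mulmxr H^T)).
    rewrite (Eb_morph (W := R^o) (@mxtrace R n)).
    apply: eq_Eb => s a' s' r /=.
    by rewrite scaleN1r -scalemxAr -scalerBr -!scalemxAl mxtraceZ mulmxBl mulmxA.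
  by rewrite /F mulmxKV // subrr mul0mx mxtrace0.
have lossE : loss G = loss F +
    Eb (V := R^o) (fun s a' _ _ => (a' == a)%:R * sqnorm (H *m x s)).
  rewrite -[RHS]addr0 -[X in _ = _ + X](mul0r 2) -crossE mulr_natr mulr2n.
  rewrite -!EbD; apply: eq_Eb => s a' s' r.
  rewrite -!mulrDr; congr (_ * _).
  have -> : G = F + H by rewrite /H addrC subrK.
  move: (y s a' s' r) => z.
  have -> : (F + H) *m x s - z = (F *m x s - z) + H *m x s.
    by rewrite mulmxDl addrAC.
  move: (F *m x s - z) => u; rewrite -mulmxA -trmx_mul.
  move: (H *m x s) => v; rewrite !sqnormE linearD /= mulmxDl !mulmxDr !mxtraceD.
  rewrite -[\tr (v *m u^T)]mxtrace_tr trmx_mul trmxK.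
  by rewrite [X in _ + X = _]addrC addrACA.
have nn s a' (s' : state M) (r : R) : 0 <= (a' == a)%:R * sqnorm (H *m x s).
  by rewrite mulr_ge0 ?sqnorm_ge0.
rewrite lossE ltrDl lt_neqAle Eb_ge0 // andbT eq_sym.
apply: contra GF => /eqP E0.
have : H *m second_moment a = 0.
  rewrite /second_moment (Eb_morph (mulmx H)); apply: Eb_eq0 E0 => // s a' s' r /=.
  case: eqP => _; last by rewrite scale0r mulmx0.
  by rewrite mul1r scale1r mulmxA => /sqnorm_eq0 ->; rewrite mul0mx.
move/(congr1 (mulmx^~ (invmx (second_moment a)))).
by rewrite mulmxK // mul0mx => /subr0_eq /eqP.
Qed.

Lemma Fstar_argmin (a : action M) (G : 'M[R]_m) :
  second_moment a \in unitmx -> G != Fstar a ->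
  Fstar_loss a (Fstar a) < Fstar_loss a G.
Proof. exact: (@least_squares m (fun _ _ s' _ => x s') a G). Qed.

Lemma bstar_argmin (a : action M) (u : 'cV[R]_m) :
  second_moment a \in unitmx -> u != bstar a ->
  bstar_loss a (bstar a) < bstar_loss a u.
Proof.
move=> Cu ub.
have lossE v : bstar_loss a v = Eb (V := R^o) (fun s a' _ r =>
    (a' == a)%:R * sqnorm (v^T *m x s - r%:M : 'cV_1)).
  by apply: (@eq_Eb R^o) => s a' s' r; rewrite /sqnorm big_ord1 !mxE eqxx mulr1n.
have bE : (bstar a)^T = Eb (fun s a' _ r =>
    (a' == a)%:R *: ((r%:M : 'cV_1) *m (x s)^T)) *m invmx (second_moment a).
  rewrite /bstar trmx_mul trmx_inv (Eb_morph (@trmx R m 1)).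
  congr (_ *m invmx _).
    by apply: eq_Eb => s a' s' r; rewrite !linearZ /= mul_scalar_mx.
  rewrite /second_moment (Eb_morph (@trmx R m m)); apply: eq_Eb => s a' s' r.
  by rewrite linearZ /= trmx_mul trmxK.
rewrite !lossE bE; apply: least_squares => //.
by rewrite -bE (inj_eq trmx_inj).
Qed.

End LeastSquares.

End TD.

(* Main.v *)
(* Given a feature vector phi, both TD(0) on real data and TD(0) on the best
   non-linear model average over the states with feature vector phi, weighted
   by eta; since the policies only see phi, importance sampling commutes with
   this averaging, and the two linear systems coincide. The best linear model
   is fitted under b instead of pi, and one weight cannot fit features of
   opposite signs: take two states with features 1 and -1, visited by fair coin
   flips whatever the actions, b uniform, pi playing the action that matches
   the current state, and reward 1 for action [true] in state [true] only. Then
   w_env = 1/2 while w_linear = 1/4. *)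
Require Import Defs.
From mathcomp Require Import all_boot all_order all_algebra finmap.
From mathcomp Require Import boolp classical_sets cardinality fsbigop reals.
From mathcomp Require Import lra.

Set Implicit Arguments.
Unset Strict Implicit.
Unset Printing Implicit Defensive.
Import Order.TTheory GRing.Theory Num.Theory.
Local Open Scope classical_set_scope.
Local Open Scope ring_scope.

(** * Regrouping sums over states by feature vector *)

Section FeatureFibers.
Context {R : realType} (M : mdp R) (m : nat).
Context (x : state M -> 'cV[R]_m) (eta : state M -> R).

Let features : {fset 'cV[R]_m} := [fset x s | s in state M]%fset.

Lemma x_features s : x s \in features.
Proof. by apply/imfsetP; exists s. Qed.

Lemma sum_fibers (V : nmodType) (G : state M -> V) :
  \sum_s G s = \sum_(phi <- features) \sum_(s | x s == phi) G s.
Proof.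
rewrite (exchange_big_dep predT) //=; apply: eq_bigr => s _.
under eq_bigl => phi do rewrite eq_sym.
by rewrite -big_filter filter_pred1_uniq ?fset_uniq ?x_features ?big_seq1.
Qed.

Lemma mu_notin phi : phi \notin features -> mu x eta phi = 0.
Proof.
move=> phiN; rewrite /mu big_pred0 // => s.
by apply: contraNF phiN => /eqP <-; exact: x_features.
Qed.

(** Makes the sums over all vectors in [Ezeta] and [finite_pmf] tractable: off the finite image of
    [x] the mass [mu] is zero. *)
Lemma fsum_features (V : lmodType R) (G : 'cV[R]_m -> V) :
    (forall phi, mu x eta phi = 0 -> G phi = 0) ->
  \sum_(phi \in [set: 'cV[R]_m]) G phi = \sum_(phi <- features) G phi.
Proof. by move=> G0; apply: fsbigTE => phi /mu_notin /G0. Qed.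

(** Both [f] and [pi] are constant on each fiber of [x], so the mass [mu] splits back into the
    weights [eta] of the states. The counterexample evaluates [zeta_moment], [F_lin] and [b_lin] in
    this form. *)
Lemma Ezeta_mu (V : lmodType R) (pi : policy R m (action M))
    (f : 'cV[R]_m -> action M -> V) :
  Ezeta pi (mu x eta) f = \sum_s \sum_a (eta s * pi (x s) a) *: f (x s) a.
Proof.
rewrite /Ezeta fsum_features => [|phi mu0]; last first.
  by rewrite big1 // => a _; rewrite mu0 mul0r scale0r.
rewrite sum_fibers; apply: eq_bigr => phi _.
rewrite exchange_big /=; apply: eq_bigr => a _.
rewrite /mu mulr_suml scaler_suml.
by apply: eq_bigr => s /eqP ->.
Qed.

Context (eta_ge0 : forall s, 0 <= eta s).

Lemma mu_ge0 phi : 0 <= mu x eta phi.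
Proof. exact: sumr_ge0. Qed.

Lemma finite_pmf_mu : \sum_s eta s = 1 -> finite_pmf (mu x eta).
Proof.
move=> eta1; split; first exact: mu_ge0.
  apply: (sub_finite_set (B := [set` features])) => [phi /= |].
    by apply: contraR => /mu_notin ->.
  exact: finite_fset.
rewrite (@fsum_features R^o) // -[RHS]eta1 [RHS]sum_fibers.
by apply: eq_bigr.
Qed.

(** * Importance sampling and the best non-linear model *)

Context (b pi : policy R m (action M)).
Context (coverage : forall phi a,
  0 < mu x eta phi -> 0 < pi phi a -> 0 < b phi a).

(* Importance sampling turns E_b into an expectation under eta and pi; the
   fibers of x then regroup it as an expectation under mu and pi. *)
Lemma Ezeta_rho (V : lmodType R) (f : 'cV[R]_m -> action M -> V)
    (g : state M -> action M -> state M -> R -> V) :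
    (forall phi a, 0 < mu x eta phi -> 0 < b phi a ->
      mu x eta phi *: f phi a = \sum_(s | x s == phi)
        eta s *: \sum_s' \sum_(r : rewards M) dyn s' r s a *: g s a s' (val r)) ->
  Ezeta pi (mu x eta) f =
  Eb x b eta (fun s a s' r => rho x b pi s a *: g s a s' r).
Proof.
move=> fg.
have -> : Eb x b eta (fun s a s' r => rho x b pi s a *: g s a s' r) =
    \sum_s \sum_a (eta s * b (x s) a * rho x b pi s a) *:
      \sum_s' \sum_(r : rewards M) dyn s' r s a *: g s a s' (val r).
  apply: eq_bigr => s _; apply: eq_bigr => a _; rewrite scaler_sumr.
  apply: eq_bigr => s' _; rewrite scaler_sumr; apply: eq_bigr => r _.
  by rewrite !scalerA mulrAC.
rewrite /Ezeta fsum_features => [|phi mu0]; last first.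
  by rewrite big1 // => a _; rewrite mu0 mul0r scale0r.
rewrite sum_fibers; apply: eq_bigr => phi _.
rewrite exchange_big /=; apply: eq_bigr => a _.
(* The hypothesis on [f] is silent where [mu] or [b] vanishes. On a fiber of zero mass every weight
   [eta s] is zero, by nonnegativity. *)
have [mu0|mu_neq0] := eqVneq (mu x eta phi) 0.
  rewrite mu0 mul0r scale0r big1 // => s sphi.
  by rewrite (psumr_eq0P _ mu0) // !mul0r scale0r.
have mu_gt0 : 0 < mu x eta phi by rewrite lt0r mu_neq0 mu_ge0.
(* Coverage speaks only where [pi] is positive; elsewhere the numerator of [rho] is zero, whatever
   [b] is. *)
have [pi0|pi_neq0] := eqVneq (pi phi a) 0.
  rewrite pi0 mulr0 scale0r big1 // => s /eqP sphi.
  by rewrite /rho sphi pi0 mul0r mulr0 scale0r.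
have b_gt0 : 0 < b phi a.
  by apply: coverage => //; rewrite lt0r pi_neq0 policy_ge0.
rewrite mulrC -scalerA fg // scaler_sumr; apply: eq_bigr => s /eqP sphi.
rewrite scalerA /rho sphi -mulrA (mulrCA (b _ _)) mulfV ?gt_eqF //.
by rewrite mulr1 mulrC.
Qed.

(** Multiplying by [mu phi] cancels the normalization of [xhat] and leaves the fiber sum that
    [Ezeta_rho] asks for. *)
Lemma A_nonlinear_env gamma :
  A_nonlinear x gamma b pi eta (mu x eta) = A_env x gamma b pi eta.
Proof.
apply: Ezeta_rho => phi a mu_gt0 b_gt0.
(* The term without [xhat] involves no next state; since the dynamics sum to 1, it can be spread
   over all outcomes and combined with the [xhat] term under the same sums. *)
have fiber1 (V : lmodType R) (v : V) :
    mu x eta phi *: v = \sum_(s | x s == phi) eta s *: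
      \sum_s' \sum_(r : rewards M) dyn s' r s a *: v.
  rewrite /mu scaler_suml; apply: eq_bigr => s _; congr (_ *: _).
  rewrite -[LHS]scale1r -(dyn_sum1 s a) scaler_suml.
  by apply: eq_bigr => s' _; rewrite scaler_suml.
rewrite linearB /= linearZ /= mulmxBr scalerBr fiber1.
rewrite -scalemxAr scalerA mulrC -scalerA /xhat Eb_cond_state //.
rewrite [(_ *: _)^T]linearZ /= -scalemxAr (scalerA (mu _ _ _)).
rewrite mulfV ?gt_eqF // scale1r.
rewrite linear_sum /= mulmx_sumr scaler_sumr -sumrB.
apply: eq_bigr => s /eqP sphi.
rewrite [(_ *: _)^T]linearZ /= -scalemxAr scalerA.
rewrite [gamma * _]mulrC -scalerA -scalerBr.
congr (_ *: _); rewrite linear_sum /= mulmx_sumr scaler_sumr -sumrB.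
apply: eq_bigr => s' _.
rewrite linear_sum /= mulmx_sumr scaler_sumr -sumrB.
apply: eq_bigr => r _.
rewrite [(_ *: _)^T]linearZ /= -scalemxAr scalerA.
rewrite [gamma * _]mulrC -scalerA -scalerBr.
by rewrite sphi [(_ - _)^T]linearB /= [(_ *: _)^T]linearZ mulmxBr -scalemxAr.
Qed.

Lemma w_nonlinear_env gamma :
  w_nonlinear x gamma b pi eta (mu x eta) = w_env x gamma b pi eta.
Proof.
rewrite /w_nonlinear /w_env A_nonlinear_env; congr (_ *m _).
rewrite (@Ezeta_rho _ _ (fun s _ _ r => r *: x s)) => [|phi a mu_gt0 b_gt0].
  by apply: eq_Eb => s a s' r; rewrite scalerA.
rewrite /rhat Eb_cond_state // scalerA.
rewrite mulrA mulfV ?gt_eqF // mul1r scaler_suml.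
apply: eq_bigr => s /eqP sphi; rewrite -scalerA; congr (_ *: _).
rewrite scaler_suml; apply: eq_bigr => s' _.
by rewrite scaler_suml; apply: eq_bigr => r _; rewrite -scalerA sphi.
Qed.

End FeatureFibers.

(** * The coin-flip counterexample *)

Section Counterexample.
Context (R : realType).

Definition coin_rewards : {fset R} := [fset 0; 1]%fset.

Lemma coin_reward_subproof (c : bool) : c%:R \in coin_rewards.
Proof. by case: c; rewrite !inE eqxx ?orbT. Qed.

Definition coin_dyn (s' : bool) (r : coin_rewards) (s a : bool) : R :=
  2^-1 * (val r == (s && a)%:R)%:R.

Lemma sum_coin_rewards (V : lmodType R) (c : bool) (k : R) (g : R -> V) :
  \sum_(r : coin_rewards) (k * (val r == c%:R)%:R) *: g (val r) = k *: g c%:R.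
Proof.
rewrite (bigD1 [` coin_reward_subproof c]%fset) //= eqxx mulr1.
rewrite big1 ?addr0 // => r /negPf; rewrite -val_eqE /= => ->.
by rewrite mulr0 scale0r.
Qed.

Lemma coin_dyn_ge0 s' r s a : 0 <= coin_dyn s' r s a.
Proof. by rewrite mulr_ge0 // invr_ge0. Qed.

Lemma coin_reward_sum (s' s a : bool) : \sum_r coin_dyn s' r s a = 2^-1.
Proof.
have := @sum_coin_rewards R^o (s && a) 2^-1 (fun=> 1).
rewrite [RHS]mulr1 => <-; apply: eq_bigr => r _; exact: esym (mulr1 _).
Qed.

Lemma coin_dyn_sum1 s a : \sum_s' \sum_r coin_dyn s' r s a = 1.
Proof. by rewrite big_bool /= !coin_reward_sum; lra. Qed.

Definition coin_mdp : mdp R := Mdp coin_dyn_ge0 coin_dyn_sum1.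

Definition coin_feature (s : bool) : 'cV[R]_1 := ((-1) ^+ (~~ s))%:M.

Definition coin_behaviour_fun (phi : 'cV[R]_1) (a : bool) : R := 2^-1.

Lemma coin_behaviour_ge0 phi a : 0 <= coin_behaviour_fun phi a.
Proof. by rewrite invr_ge0. Qed.

Lemma coin_behaviour_sum1 phi : \sum_a coin_behaviour_fun phi a = 1.
Proof. by rewrite big_bool /= /coin_behaviour_fun; lra. Qed.

Definition coin_behaviour : policy R 1 bool :=
  Policy coin_behaviour_ge0 coin_behaviour_sum1.

(** A policy must be given on every vector and reads only the feature. The test against 1 recovers
    the state from the features 1 and -1; any other vector is treated like -1. *)
Definition coin_target_fun (phi : 'cV[R]_1) (a : bool) : R :=
  (a == (phi == 1%:M))%:R.

Lemma coin_target_ge0 phi a : 0 <= coin_target_fun phi a.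
Proof. exact: ler0n. Qed.

Lemma coin_target_sum1 phi : \sum_a coin_target_fun phi a = 1.
Proof.
rewrite big_bool /= /coin_target_fun.
by case: (phi == _); rewrite ?addr0 ?add0r.
Qed.

Definition coin_target : policy R 1 bool :=
  Policy coin_target_ge0 coin_target_sum1.

Lemma coin_targetE (s a : bool) : coin_target (coin_feature s) a = (a == s)%:R.
Proof.
rewrite /= /coin_target_fun /coin_feature; congr (_ == _)%:R.
case: s; first by rewrite expr0 eqxx.
apply/negbTE/eqP => /matrixP/(_ 0 0); rewrite !mxE /= expr1 => h; lra.
Qed.

Definition coin_eta (s : bool) : R := 2^-1.

Notation x := (coin_feature : state coin_mdp -> 'cV[R]_1).
Notation b := (coin_behaviour : policy R 1 (action coin_mdp)).
Notation pi := (coin_target : policy R 1 (action coin_mdp)).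
Notation eta := (coin_eta : state coin_mdp -> R).
Notation gamma := (2^-1 : R).

Lemma coin_eta_ge0 (s : state coin_mdp) : 0 <= eta s.
Proof. by rewrite invr_ge0. Qed.

Lemma coin_eta_sum1 : \sum_s eta s = 1.
Proof. by rewrite big_bool /= /coin_eta; lra. Qed.

(** The factor 1/8 comes from three fair choices: state, action and next state. The reward is then
    determined, so its sum has one nonzero term. *)
Lemma coin_Eb (V : lmodType R)
    (f : state coin_mdp -> action coin_mdp -> state coin_mdp -> R -> V) :
  Eb x b eta f = 8^-1 *: \sum_(s : bool) \sum_(a : bool) \sum_(s' : bool)
    f s a s' (s && a)%:R.
Proof.
rewrite scaler_sumr; apply: eq_bigr => s _.
rewrite scaler_sumr; apply: eq_bigr => a _.
rewrite scaler_sumr; apply: eq_bigr => s' _.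
rewrite -sum_coin_rewards; apply: eq_bigr => r _; congr (_ *: _).
rewrite /= /coin_dyn /coin_eta /coin_behaviour_fun mulrA; congr (_ * _).
by lra.
Qed.

Lemma coin_chain s s' : behaviour_chain x b s s' = 2^-1.
Proof.
rewrite /behaviour_chain big_bool /= !coin_reward_sum /coin_behaviour_fun; lra.
Qed.

(** One step suffices for irreducibility, and the loop of length 1 at each state forces period 1. *)
Lemma coin_nstep1 s s' : 0 < nstep (behaviour_chain x b) 1 s s'.
Proof.
rewrite /= (bigD1 s') //= eqxx mulr1 coin_chain ltr_wpDr ?invr_gt0 //.
by apply: sumr_ge0 => u _; rewrite coin_chain mulr_ge0 ?invr_ge0.
Qed.

Lemma coin_ergodic : ergodic (behaviour_chain x b).
Proof.
split=> [s s'|s d /(_ 1%N isT (coin_nstep1 s s))].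
  by exists 1%N; exact: coin_nstep1.
by rewrite dvdn1 => /eqP.
Qed.

Lemma coin_stationary : stationary (behaviour_chain x b) eta.
Proof.
split; [exact: coin_eta_ge0 | exact: coin_eta_sum1 | move=> s'].
under eq_bigr do rewrite coin_chain.
by rewrite big_bool /= /coin_eta; lra.
Qed.

Lemma coin_coverage phi a :
  0 < mu x eta phi -> 0 < pi phi a -> 0 < b phi a.
Proof. by move=> _ _; rewrite /= invr_gt0. Qed.

Lemma mx11P (A B : 'M[R]_1) : A 0 0 = B 0 0 -> A = B.
Proof. by move=> AB; apply/matrixP => i j; rewrite !ord1. Qed.

Lemma coin_second_moment a : second_moment x b eta a = (2^-1)%:M.
Proof.
apply: mx11P; rewrite /second_moment.
case: a; rewrite !coin_Eb !big_bool /= !mxE !big_ord1 !mxE /=; lra.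
Qed.

(** The next state is a fair toss independent of state and action, so its features 1 and -1 cancel
    in the cross moment. *)
Lemma coin_Fstar a : Fstar x b eta a = 0.
Proof.
rewrite /Fstar (_ : Eb _ _ _ _ = 0) ?mul0mx //; apply: mx11P.
case: a; rewrite !coin_Eb !big_bool /= !mxE !big_ord1 !mxE /=; lra.
Qed.

(** For action [true], a weight u predicts u and -u in the states with rewards 1 and 0; the
    least-squares compromise is 1/2. Action [false] is never rewarded. *)
Lemma coin_bstar a : bstar x b eta a = (if a then 2^-1 else 0)%:M.
Proof.
rewrite /bstar coin_second_moment invmx_scalar mul_scalar_mx; apply: mx11P.
case: a; rewrite !coin_Eb !big_bool /= !mxE /= ?expr1 ?expr0; lra.
Qed.

Lemma coin_zeta_moment : zeta_moment pi (mu x eta) = 1%:M.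
Proof.
apply: mx11P; rewrite /zeta_moment (Ezeta_mu x eta) !big_bool !coin_targetE.
rewrite /= !mxE !big_ord1 !mxE /= /coin_eta; lra.
Qed.

Lemma coin_A_linear : A_linear x gamma b pi eta (mu x eta) = 1%:M.
Proof.
rewrite /A_linear /F_lin (Ezeta_mu x eta) big1 => [|s _]; last first.
  by rewrite big1 // => a _; rewrite coin_Fstar !mul0mx scaler0.
by rewrite mul0mx trmx0 scaler0 subr0.
Qed.

(** Under [pi], action [true] with its weight 1/2 occurs only in state [true], of mass 1/2; the
    other state contributes 0. *)
Lemma coin_w_linear : w_linear x gamma b pi eta (mu x eta) = (4^-1)%:M.
Proof.
rewrite /w_linear coin_A_linear /b_lin coin_zeta_moment invmx1 !mul1mx.
rewrite (Ezeta_mu x eta) !big_bool !coin_bstar !coin_targetE; apply: mx11P.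
rewrite /= !mxE !big_ord1 !mxE /= !big_ord1 !mxE /= /coin_eta; lra.
Qed.

Lemma coin_rho s a : rho x b pi s a = 2 * (a == s)%:R.
Proof. by rewrite /rho coin_targetE /= /coin_behaviour_fun invrK mulrC. Qed.

(** The next feature averages to zero, which removes the [gamma] term; the squared features are 1
    and the ratios average to 1. *)
Lemma coin_A_env : A_env x gamma b pi eta = 1%:M.
Proof.
apply: mx11P; rewrite /A_env coin_Eb !big_bool !coin_rho.
rewrite /= !mxE !big_ord1 !mxE /=; lra.
Qed.

(** The ratios keep only the pairs with action equal to state: reward 1 at feature 1 with reweighted
    mass 1/2, and reward 0 at feature -1. *)
Lemma coin_w_env : w_env x gamma b pi eta = (2^-1)%:M.
Proof.
rewrite /w_env coin_A_env invmx1 mul1mx; apply: mx11P.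
rewrite coin_Eb !big_bool !coin_rho /= !mxE /=; lra.
Qed.

Lemma coin_setting : td_setting x gamma b pi eta (mu x eta).
Proof.
split=> //.
- by lra.
- exact: coin_ergodic.
- exact: coin_stationary.
- move=> a; rewrite coin_second_moment -scalemx1 unitmxZ ?unitmx1 //.
  by rewrite unitfE invr_eq0 pnatr_eq0.
- exact: coin_coverage.
- apply: finite_pmf_mu; [exact: coin_eta_ge0 | exact: coin_eta_sum1].
- by rewrite coin_A_env unitmx1.
(* Non-singularity is transferred from [A_env], so [xhat] need not be computed. *)
- by rewrite (A_nonlinear_env coin_eta_ge0 coin_coverage) coin_A_env unitmx1.
- by rewrite coin_zeta_moment unitmx1.
- by rewrite coin_A_linear unitmx1.
Qed.

End Counterexample.

Theorem proposition5p1 (R : realType) :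
  (forall (M : mdp R) (m : nat) (x : state M -> 'cV[R]_m) (gamma : R)
          (b pi : policy R m (action M))
          (eta : state M -> R) (zeta : 'cV[R]_m -> R),
      td_setting x gamma b pi eta zeta ->
      w_env x gamma b pi eta = w_nonlinear x gamma b pi eta zeta)
  /\
  (exists (M : mdp R) (m : nat) (x : state M -> 'cV[R]_m) (gamma : R)
          (b pi : policy R m (action M))
          (eta : state M -> R) (zeta : 'cV[R]_m -> R),
      [/\ td_setting x gamma b pi eta zeta,
          w_env x gamma b pi eta = w_nonlinear x gamma b pi eta zeta
        & w_linear x gamma b pi eta zeta <> w_env x gamma b pi eta]).
Proof.
have env_nonlinear (M : mdp R) m (x : state M -> 'cV[R]_m) gamma
    (b pi : policy R m (action M)) (eta : state M -> R) zeta :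
    td_setting x gamma b pi eta zeta ->
    w_env x gamma b pi eta = w_nonlinear x gamma b pi eta zeta.
  by case=> _ _ [eta_ge0 _ _] _ cov _ -> _ _ _ _; rewrite w_nonlinear_env.
split=> //.
have setting := coin_setting R.
(* Apart from the dimension, all witnesses are read off by unification with [setting]. *)
eexists; exists 1%N; do 6!eexists; split; first exact: setting.
  exact: env_nonlinear setting.
rewrite coin_w_linear coin_w_env => /matrixP/(_ 0 0); rewrite !mxE /= => h.
by lra.
Qed.
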